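(* Let $F$ be a $*$-field with prime subfield $F_0$, let $d\ge1$, and let $\bar\alpha\in F_0^d$ be admissible, i.e. $\alpha_1=1$ and $\alpha_i=\alpha_i^*\neq0$ for all $i$. Let $\mathsf L=\mathsf L(F^d_{\bar\alpha})$, $n\ge1$, and $k\ge1$. (a) Let $\underline d=(d_1,\dots,d_n)$ with $0\le d_i\le d$. If $M$ is defined within $\mathsf L^{\underline d}$ by a $\Lambda_L$-formula $\phi(x_1,\dots,x_n)$ in $\Sigma_k$ (respectively in $\Pi_k$), then $\theta_{\underline d}(M)$ can be defined within $\Gamma^d_{\underline d}(F_{\bar\alpha})$ by a homogeneous $\Lambda_F$-formula in $\Sigma_k$ (respectively in $\Pi_k$). (b) If $M$ is defined within $\mathsf L^n$ by a $\Lambda_L$-formula $\phi(x_1,\dots,x_n)$ in $\Sigma_k$ (respectively in $\Pi_k$), then $\theta(M)$ can be defined within $\Gamma^d(F_{\bar\alpha})$ by a homogeneous $\Lambda_F$-formula in $\Sigma_k$ (respectively in $\Pi_k$).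
   Context: A $*$-field is a (commutative) field with an involution $r\mapsto r^*$ (possibly the identity). $F^d_{\bar\alpha}$ is the space $F^d$ of column vectors with form $\langle \underline r|\underline s\rangle=\sum_{k}r_k^*\alpha_ks_k$. $\mathsf L(F^d_{\bar\alpha})$ is the lattice of its linear subspaces with join $+$, bottom $0$ and the involution $U\mapsto U^\perp$. $\Lambda_L$ is the first order language with signature $+,0,{}^\perp$ (with $s\cap t=(s^\perp+t^\perp)^\perp$, $1=0^\perp$); $\Lambda_F$ is the language of $*$-rings with constants $0,1$. $\Sigma_k$ ($\Pi_k$) consists of prenex formulas with at most $k$ blocks of like quantifiers, the first being $\exists$ ($\forall$). $\mathsf L^{\underline d}=\{\bar u\in\mathsf L^n\mid\dim u_i=d_i\}$; ''$M$ is defined within $N$ by $\phi$'' means $M$ is the set of elements of $N$ satisfying $\phi$. Grassmann-Plücker coordinates: for $0<m\le d$, $I_m$ is the set of tuples $\bar i=(i_1<\dots<i_m)$ in $\{1,\dots,d\}$; for an $m$-dimensional subspace $U$ of $F^d$, $\mathsf P^d_m(U)\subseteq F^{I_m}$ is the set of all nonzero scalar multiples of the tuple of $m\times m$-minors $(\det B_{\bar i}\mid\bar i\in I_m)$, where $B\in F^{d\times m}$ is a matrix whose columns form a basis of $U$ and $B_{\bar i}$ consists of rows $i_1,\dots,i_m$. $\mathsf P^d_0(0)=\{0\}$ (and $|I_0|=1$). $\Gamma^d_m(F)$ is the union of all $\mathsf P^d_m(U)$ with $\dim U=m$; for $\underline r\in\Gamma^d_m(F)$, $\theta_m(\underline r)$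 is the unique $U$ with $\underline r\in\mathsf P^d_m(U)$. $\Gamma^d_{\underline d}(F_{\bar\alpha})=\Gamma^d_{d_1}(F)\times\dots\times\Gamma^d_{d_n}(F)$. For $M\subseteq\mathsf L^n$: $\theta_{\underline d}(M)=\{(\underline r_1,\dots,\underline r_n)\mid\underline r_i\in\Gamma^d_{d_i}(F),\ (\theta_{d_1}(\underline r_1),\dots,\theta_{d_n}(\underline r_n))\in M\}$, and $\theta(M)$ is the (disjoint) union of the $\theta_{\underline d}(M)$ over all $\underline d\in\{0,\dots,d\}^n$. Homogeneous formulas: variables come in strings $\bar x=(x_{\bar i}\mid\bar i\in I_m)$ of sort $m\in\{0,\dots,d\}$ (write $\bar x\in X_m$), consisting of pairwise distinct variables. A $*$-polynomial with integer coefficients (an integer combination of products of variables $x$ and their conjugates $x^*$) is homogeneous if, after replacing $x^*$ by $x$ for each variable $x$, one obtains for each string $\bar x$ a polynomial homogeneous in the variables of $\bar x$, the other variables being considered constants. A homogeneous equation is $p=0$ with $p$ a homogeneous $*$-polynomial with integer coefficients; contradiction $\bot$ and tautology $\top$ are also counted as homogeneous equations. A $\Lambda_F$-formula is homogeneous if all its atomic subformulas are homogeneous equations. Homogeneous formulas are interpreted in the multi-sorted structure $\Gamma^d(F_{\bar\alpha})$ with sorts $\Gamma^d_m(F)$, $0\le m\le d$: strings $\bar x\in X_m$ (free or quantified) take values in $\Gamma^d_m(F)$. A homogeneous formula defining $\theta(M)$ within $\Gamma^d(F_{\bar\alpha})$ is understood as a disjunction, over all $\underline d\in\{0,\dots,d\}^n$,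 of homogeneous formulas $\chi_{\underline d}$ with free strings $\bar x_1\in X_{d_1},\dots,\bar x_n\in X_{d_n}$, where $\chi_{\underline d}$ defines the component $\theta_{\underline d}(M)$ within $\Gamma^d_{\underline d}(F_{\bar\alpha})$; it is in $\Sigma_k$ ($\Pi_k$) if all the $\chi_{\underline d}$ are. *)

(* Defs.v *)
From HB Require Import structures.
From mathcomp Require Import all_boot all_order all_algebra.
From mathcomp Require Import finmap monalg.

Set Implicit Arguments.
Unset Strict Implicit.
Unset Printing Implicit Defensive.

Import GRing.Theory.
Local Open Scope ring_scope.

Inductive quantifier := Qex | Qall.

Definition dual (q : quantifier) : quantifier :=
  if q is Qex then Qall else Qex.

(** First order formulas with atoms in [A]; a quantifier binds an element of
    [V], which is a variable, or a whole string of variables in the multi-sorted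
    case. *)
Inductive formula (V A : Type) : Type :=
| Atom of A
| Not of formula V A
| And of formula V A & formula V A
| Or of formula V A & formula V A
| Imp of formula V A & formula V A
| Quant of quantifier & V & formula V A.
Arguments Atom {V A}.
Arguments Not {V A}.
Arguments And {V A}.
Arguments Or {V A}.
Arguments Imp {V A}.
Arguments Quant {V A}.

Section Syntax.
Variables V A : Type.
Implicit Types f g : formula V A.

Fixpoint quantifier_free f : bool :=
  match f with
  | Atom _ => true
  | Not g => quantifier_free g
  | And g h | Or g h | Imp g h => quantifier_free g && quantifier_free h
  | Quant _ _ _ => false
  end.

(** [prenex q k f]: [f] is a prefix of at most [k] blocks of like quantifiers,
    the first block being of kind [q], followed by a quantifier free formula;
    so [prenex Qex k] is Sigma_k and [prenex Qall k] is Pi_k. *)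
Inductive prenex : quantifier -> nat -> formula V A -> Prop :=
| PrenexQF q k f : quantifier_free f -> prenex q k f
| PrenexSame q k x f : prenex q k.+1 f -> prenex q k.+1 (Quant q x f)
| PrenexSwitch q k x f : prenex (dual q) k f -> prenex q k.+1 (Quant q x f).

Fixpoint all_atoms (P : A -> Prop) f : Prop :=
  match f with
  | Atom a => P a
  | Not g | Quant _ _ g => all_atoms P g
  | And g h | Or g h | Imp g h => all_atoms P g /\ all_atoms P h
  end.

(** [occurs a x]: [x] occurs in the atom [a]. *)
Fixpoint is_free (occurs : A -> V -> Prop) (x : V) f : Prop :=
  match f with
  | Atom a => occurs a x
  | Not g => is_free occurs x g
  | And g h | Or g h | Imp g h => is_free occurs x g \/ is_free occurs x h
  | Quant _ y g => x <> y /\ is_free occurs x g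
  end.

End Syntax.

Section Semantics.
Variables (V : eqType) (A : Type) (T : V -> Type).
(** [dom x] is the set of values which a quantified [x] ranges over. *)
Variables (dom : forall x, T x -> Prop) (sat_atom : (forall x, T x) -> A -> Prop).

Fixpoint sat (e : forall x, T x) (f : formula V A) : Prop :=
  match f with
  | Atom a => sat_atom e a
  | Not g => ~ sat e g
  | And g h => sat e g /\ sat e h
  | Or g h => sat e g \/ sat e h
  | Imp g h => sat e g -> sat e h
  | Quant Qex x g => exists2 v : T x, dom v & sat (dfwith e v) g
  | Quant Qall x g => forall v : T x, dom v -> sat (dfwith e v) g
  end.

End Semantics.

Definition prime_subfield (F : fieldType) (a : F) : Prop :=
  forall S : F -> Prop,
    S 1 ->
    (forall x y, S x -> S y -> S (x - y)) ->
    (forall x y, S x -> S y -> S (x / y)) ->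
    S a.

Section SubspaceLattice.
Variables (F : fieldType) (star : {rmorphism F -> F}) (d : nat).
Variable alpha : 'I_d -> F.

Definition admissible : Prop :=
  (forall i : 'I_d, i = 0%N :> nat -> alpha i = 1) /\
  (forall i, star (alpha i) = alpha i /\ alpha i != 0).

Definition form (r s : 'cV[F]_d) : F^o :=
  \sum_k star (r k 0) * alpha k * s k 0.

Fact form_linear r : linear (form r).
Proof.
move=> a s t; rewrite /form scaler_sumr -big_split; apply: eq_bigr => k _ /=.
by rewrite !mxE mulrDr mulrCA.
Qed.

HB.instance Definition _ r :=
  GRing.isLinear.Build F 'cV[F]_d F^o _ (form r) (form_linear r).

Definition perp (U : {vspace 'cV[F]_d}) : {vspace 'cV[F]_d} :=
  (\bigcap_(i < \dim U) lker (linfun (form (vbasis U)`_i)))%VS.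

Lemma mem_perp (U : {vspace 'cV[F]_d}) (s : 'cV[F]_d) :
  reflect (forall r, r \in U -> form r s = 0) (s \in perp U).
Proof.
rewrite memvE; apply: (iffP subv_bigcapP) => [hs r rU | hs i _].
  have h0 i : form (vbasis U)`_i s = 0 :> F.
    case: (ltnP i (\dim U)) => [lti | gei].
      have := hs (Ordinal lti) isT.
      by rewrite -memvE memv_ker lfunE => /eqP.
    rewrite nth_default ?size_tuple // /form big1 // => k _.
    by rewrite mxE rmorph0 !mul0r.
  rewrite (coord_vbasis rU) /form.
  under eq_bigr => k _ do rewrite summxE rmorph_sum !mulr_suml.
  rewrite exchange_big big1 //= => i _.
  under eq_bigr => k _ do rewrite mxE rmorphM -!mulrA mulrA -mulrA.
  rewrite -mulr_sumr; under eq_bigr => k _ do rewrite mulrA.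
  by rewrite [X in _ * X](h0 i) mulr0.
rewrite -memvE memv_ker lfunE; apply/eqP/hs/vbasis_mem.
by rewrite mem_nth // size_tuple.
Qed.

End SubspaceLattice.

Inductive lterm : Type :=
| LVar of nat
| LZero
| LJoin of lterm & lterm
| LPerp of lterm.

Fixpoint lterm_occurs (t : lterm) (x : nat) : Prop :=
  match t with
  | LVar y => x = y
  | LZero => False
  | LJoin s t => lterm_occurs s x \/ lterm_occurs t x
  | LPerp s => lterm_occurs s x
  end.

(** The atom [(s, t)] is the equation [s = t]. *)
Notation latom := (lterm * lterm)%type.
Notation lformula := (formula nat latom).

Definition latom_occurs (a : latom) (x : nat) : Prop :=
  lterm_occurs a.1 x \/ lterm_occurs a.2 x.

Section LatticeSemantics.
Variables (F : fieldType) (star : {rmorphism F -> F}) (d : nat).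
Variable alpha : 'I_d -> F.
Local Notation L := {vspace 'cV[F]_d}.

Fixpoint leval (e : nat -> L) (t : lterm) : L :=
  match t with
  | LVar x => e x
  | LZero => 0%VS
  | LJoin s t => (leval e s + leval e t)%VS
  | LPerp s => perp star alpha (leval e s)
  end.

Definition lsat (e : nat -> L) (f : lformula) : Prop :=
  sat (T := fun=> L) (fun _ _ => True)
    (fun e a => leval e a.1 = leval e a.2) e f.

(** The free variables x_1, ..., x_n are numbered from 0 on; the value [0%VS] of
    the others is immaterial. *)
Definition ldefines n (N : n.-tuple L -> Prop) (f : lformula)
    (M : n.-tuple L -> Prop) : Prop :=
  (forall x, is_free latom_occurs x f -> (x < n)%N) /\
  (forall u : n.-tuple L, M u <-> N u /\ lsat (nth 0%VS u) f).

End LatticeSemantics.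

(** Strictly increasing [m]-tuples in ['I_d]; there is just one for [m = 0]. *)
Notation subindex d m :=
  {t : m.-tuple 'I_d | sorted (fun i j : 'I_d => (i < j)%N) t}.

Notation coords F d m := {ffun subindex d m -> F}.

Section GrassmannPluecker.
Variables (F : fieldType) (d : nat).
Local Notation L := {vspace 'cV[F]_d}.

Definition minors m (B : 'M[F]_(d, m)) : coords F d m :=
  [ffun i => \det (rowsub (tnth (val i)) B)].

(** For [m = 0] the convention is that the coordinate of the subspace 0 is the
    scalar 0 and not the empty determinant. *)
Definition pluecker m (U : L) (r : coords F d m) : Prop :=
  \dim U = m /\
  (if m == 0%N then r = 0 else
   exists (B : 'M[F]_(d, m)) (c : F),
     [/\ basis_of U [tuple col j B | j < m], c != 0 & r = [ffun i => c * minors B i]]).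

Definition Gamma m (r : coords F d m) : Prop := exists U, pluecker U r.

(** [pluecker U r] determines [U] from [r]: [U] is the subspace with coordinates
    [r]. *)
Definition theta n (dd : n.-tuple 'I_d.+1) (M : n.-tuple L -> Prop)
    (r : forall i : 'I_n, coords F d (tnth dd i)) : Prop :=
  exists2 U : n.-tuple L, (forall i, pluecker (tnth U i) (r i)) & M U.

End GrassmannPluecker.
Arguments theta {F d n} dd M r.

Section HomogeneousFormulas.
Variable d : nat.

(** A string of variables is given by its sort and its number; its individual
    variables are indexed by [subindex d] of the sort. *)
Notation string := ('I_d.+1 * nat)%type.
Definition sort_of (x : string) : nat := x.1.
Notation var := {x : string & subindex d (sort_of x)}.

(** [(v, false)] stands for the variable [v], and [(v, true)] for [v^*]. *)
Notation star_monomial := {cmonom (var * bool)%type}.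
Notation star_poly := {malg int[star_monomial]}.

(** Degree in the string [x] once each [v^*] is replaced by [v]. *)
Definition string_degree (x : string) (m : star_monomial) : nat :=
  (\sum_(i : subindex d (sort_of x)) \sum_(b : bool) m (Tagged _ i, b))%N.

(** Degrees are compared monomial by monomial, without the cancellations which
    replacing [v^*] by [v] might cause: [v - v^* + 1] is not homogeneous. *)
Definition homogeneous_poly (p : star_poly) : Prop :=
  forall x : string, exists D : nat,
    forall m, m \in msupp p -> string_degree x m = D.

Definition star_poly_occurs (p : star_poly) (x : string) : Prop :=
  exists m, m \in msupp p /\ exists i b, m (@Tagged _ x _ i, b) != 0%N.

Inductive hatom : Type :=
| HEq0 of star_poly
| HBot
| HTop.

Definition hformula : Type := formula string hatom.

Definition homogeneous_atom (a : hatom) : Prop :=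
  if a is HEq0 p then homogeneous_poly p else True.

Definition homogeneous (f : hformula) : Prop := all_atoms homogeneous_atom f.

Definition hatom_occurs (a : hatom) (x : string) : Prop :=
  if a is HEq0 p then star_poly_occurs p x else False.

Section HomogeneousSemantics.
Variables (F : fieldType) (star : {rmorphism F -> F}).
Local Notation valuation := (forall x : string, coords F d (sort_of x)).

Definition monomial_eval (e : valuation) (m : star_monomial) : F :=
  \prod_(v <- finsupp m)
    (if v.2 then star (e (tag v.1) (tagged v.1)) else e (tag v.1) (tagged v.1))
      ^+ m v.

Definition star_poly_eval (e : valuation) (p : star_poly) : F :=
  mmap intr (monomial_eval e) p.

Definition hatom_sat (e : valuation) (a : hatom) : Prop :=
  match a with
  | HEq0 p => star_poly_eval e p = 0
  | HBot => False
  | HTop => True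
  end.

Definition hsat (e : valuation) (f : hformula) : Prop :=
  sat (fun x => @Gamma F d (sort_of x)) hatom_sat e f.

(** The free string x_i of sort [d_i]. *)
Definition free_string n (dd : n.-tuple 'I_d.+1) (i : 'I_n) : string :=
  (tnth dd i, val i).

Definition hdefines n (dd : n.-tuple 'I_d.+1) (f : hformula)
    (N : (forall i : 'I_n, coords F d (tnth dd i)) -> Prop) : Prop :=
  (forall x, is_free hatom_occurs x f -> exists i, x = free_string dd i) /\
  (forall e : valuation,
     N (fun i => e (free_string dd i)) <->
     (forall i, Gamma (e (free_string dd i))) /\ hsat e f).

End HomogeneousSemantics.
End HomogeneousFormulas.
Arguments hdefines {d F} star {n} dd f N.

(* Main.v *)
Require Import Defs.
From HB Require Import structures.
From mathcomp Require Import all_boot all_order all_algebra.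
From mathcomp Require Import finmap monalg.
From mathcomp Require Import perm.
From Stdlib Require Import ClassicalEpsilon FunctionalExtensionality.

(** Every subspace with Grassmann-Pluecker coordinates [r] is spanned by columns
    whose entries are coordinates of [r] up to sign (Cramer's rule).  Starting
    from these, the value of a lattice term is spanned by the columns of a matrix
    of polynomials, each column being homogeneous: joins concatenate columns, and
    orthogonals are kernels, for which Cramer's rule gives homogeneous solutions
    as soon as one knows a nonvanishing minor of maximal size.  This knowledge is
    a quantifier free homogeneous condition, and so is inclusion of column spaces,
    hence a quantifier free lattice formula becomes a quantifier free homogeneous
    one.  The constants [alpha] are made integral by a common denominator.

    A quantifier over subspaces is a disjunction or conjunction, over the
    dimensions [m], of quantifiers over strings of sort [m].  These Boolean
    connectives are moved inwards past all quantifiers, with independent strings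
    in the different branches, which preserves the blocks of the prefix. *)

Set Implicit Arguments.
Unset Strict Implicit.
Unset Printing Implicit Defensive.

Import GRing.Theory.
Local Open Scope ring_scope.

(** * Homogeneous functions *)

Section HomogeneousFunctions.
Variables (d : nat) (F : fieldType) (star : {rmorphism F -> F}).
Local Notation string := ('I_d.+1 * nat)%type.
Local Notation valuation := (forall x : string, coords F d (sort_of x)).
Local Notation var := {x : string & subindex d (sort_of x)}.
Local Notation star_monomial := {cmonom (var * bool)%type}.
Local Notation star_poly := {malg int[star_monomial]}.

(** Variables outside the support have exponent 0 and contribute the factor 1. Over a common index
    set [A], the evaluations of several monomials multiply factor by factor. *)
Lemma monomial_evalE (e : valuation) (m : star_monomial)
    (A : {fset (var * bool)%type}) :
  (finsupp m `<=` A)%fset ->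
  monomial_eval star e m = \prod_(v <- A)
    (if v.2 then star (e (tag v.1) (tagged v.1)) else e (tag v.1) (tagged v.1))
      ^+ m v.
Proof.
move=> sub; rewrite /monomial_eval; apply: big_fset_incl => // v _.
by rewrite memNfinsupp => /eqP ->; rewrite expr0.
Qed.

Fact monomial_eval_multiplicative (e : valuation) : mmorphism (monomial_eval star e).
Proof.
split=> [m1 m2|]; last by rewrite /monomial_eval mdom1 big_seq_fset0.
have sub1 : (finsupp m1 `<=` finsupp (mmul m1 m2))%fset.
  by rewrite mdomD fsubsetUl.
have sub2 : (finsupp m2 `<=` finsupp (mmul m1 m2))%fset.
  by rewrite mdomD fsubsetUr.
rewrite (monomial_evalE _ sub1) (monomial_evalE _ sub2) /monomial_eval.
by rewrite -big_split; apply: eq_bigr => v _; rewrite /= cmM exprD.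
Qed.

HB.instance Definition _ (e : valuation) := isMultiplicative.Build star_monomial F
  (monomial_eval star e) (monomial_eval_multiplicative e).

Lemma string_degreeM (x : string) (m1 m2 : star_monomial) :
  string_degree x (mmul m1 m2) = (string_degree x m1 + string_degree x m2)%N.
Proof.
rewrite /string_degree -big_split; apply: eq_bigr => i _.
by rewrite -big_split; apply: eq_bigr => b _; rewrite /= cmM.
Qed.

Lemma string_degree1 (x : string) : string_degree x mone = 0%N.
Proof. by rewrite /string_degree big1 // => i _; rewrite big1 // => b _; rewrite cm1. Qed.

Lemma string_degreeU (x : string) (v : var) b :
  string_degree x (ucm (v, b)) = (tag v == x).
Proof.
rewrite /string_degree; case: v => y j /=.
have [<-|ne] := eqVneq y x.
  rewrite (bigD1 j) //= (bigD1 b) //= !cmU eqxx !big1 ?addn0 // => [i ij|c cb].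
    rewrite big1 // => c _; rewrite cmU xpair_eqE -tag_eqE /tag_eq eqxx /=.
    by rewrite tagged_asE eq_sym (negbTE ij).
  by rewrite cmU xpair_eqE [b == c]eq_sym (negbTE cb) andbF.
rewrite big1 // => i _; rewrite big1 // => c _.
by rewrite cmU xpair_eqE -tag_eqE /tag_eq /= (negbTE ne).
Qed.

(** The degree [D] is a parameter because only functions of equal degree may be added; the zero
    function has every degree. [S] keeps track of the strings that may become free in a formula. *)
Definition poly_fun (S : string -> Prop) (D : string -> nat) (f : valuation -> F) :=
  exists p : star_poly,
    [/\ forall e, star_poly_eval star e p = f e,
        forall m, m \in msupp p -> forall x, string_degree x m = D x &
        forall x, star_poly_occurs p x -> S x].

(** The conjugate is included to make the notion stable under conjugation. *)
Definition hom_fun S D (f : valuation -> F) :=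
  poly_fun S D f /\ poly_fun S D (fun e => star (f e)).

Lemma poly_fun_ext S D f g :
  (forall e, f e = g e) -> poly_fun S D f -> poly_fun S D g.
Proof. by move=> fg [p [pf pD pS]]; exists p; split=> // e; rewrite pf. Qed.

Lemma hom_fun_ext S D f g :
  (forall e, f e = g e) -> hom_fun S D f -> hom_fun S D g.
Proof.
by move=> fg [f1 f2]; split; [apply: poly_fun_ext f1|apply: poly_fun_ext f2 => e; rewrite fg].
Qed.

Lemma poly_fun_degree S D D' f :
  (forall x, D x = D' x) -> poly_fun S D f -> poly_fun S D' f.
Proof.
by move=> DD [p [pf pD pS]]; exists p; split=> // m mp x; rewrite -DD pD.
Qed.

Lemma hom_fun_degree S D D' f :
  (forall x, D x = D' x) -> hom_fun S D f -> hom_fun S D' f.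
Proof. by move=> DD [f1 f2]; split; apply: poly_fun_degree DD _. Qed.

Lemma poly_fun0 S D : poly_fun S D (fun=> 0).
Proof.
exists 0; split=> [e|m|x [m []]]; last by rewrite msupp0.
  by rewrite /star_poly_eval mmap0.
by rewrite msupp0.
Qed.

Lemma poly_funD S D f g :
  poly_fun S D f -> poly_fun S D g -> poly_fun S D (fun e => f e + g e).
Proof.
move=> [p [pf pD pS]] [r [rg rD rS]]; exists (p + r); split=> [e|m|x [m []]].
- by rewrite /star_poly_eval mmapD -pf -rg.
- by move=> /(fsubsetP (msuppD_le _ _)); rewrite in_fsetU => /orP[/pD|/rD].
move=> /(fsubsetP (msuppD_le _ _)); rewrite in_fsetU => /orP[mp|mr] mx.
  by apply: pS; exists m.
by apply: rS; exists m.
Qed.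

Lemma poly_funM S D D' f g :
  poly_fun S D f -> poly_fun S D' g ->
  poly_fun S (fun x => D x + D' x)%N (fun e => f e * g e).
Proof.
move=> [p [pf pD pS]] [r [rg rD rS]]; exists (p * r); split=> [e|m|x [m []]].
- rewrite /star_poly_eval.
  have /= [-> _] := mmap_is_multiplicative (f := intr) (h := monomial_eval star e).
  by rewrite -/(star_poly_eval _ _ _) pf -/(star_poly_eval _ _ _) rg.
- move=> /msuppM_le [m1 [m2 [m1p m2r ->]]] x.
  by rewrite string_degreeM (pD _ m1p) (rD _ m2r).
move=> /msuppM_le [m1 [m2 [m1p m2r ->]]] [i [b]].
rewrite cmM addn_eq0 negb_and => /orP[m1x|m2x].
  by apply: pS; exists m1; split=> //; exists i, b.
by apply: rS; exists m2; split=> //; exists i, b.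
Qed.

Lemma poly_fun_int S (z : int) : poly_fun S (fun=> 0%N) (fun=> z%:~R).
Proof.
exists z%:MP; split=> [e|m|x [m []]].
- by rewrite /star_poly_eval mmapC.
- move=> mz x; have := fsubsetP (msuppC_le z) _ mz; rewrite in_fset1 => /eqP ->.
  exact: string_degree1.
move=> mz [i [b]]; have := fsubsetP (msuppC_le z) _ mz; rewrite in_fset1 => /eqP ->.
by rewrite cm1.
Qed.

Lemma poly_fun_var (S : string -> Prop) x (i : subindex d (sort_of x)) b : S x ->
  poly_fun S (fun y => (x == y : nat))
    (fun e => if b then star (e x i) else e x i).
Proof.
pose v : var := Tagged _ i; move=> Sx; exists << ucm (v, b) >>.
split=> [e|m|y [m []]].
- by rewrite /star_poly_eval mmapU mul1r /monomial_eval mdomU big_seq_fset1 cmUU expr1.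
- by rewrite msuppU1 in_fset1 => /eqP -> y; rewrite string_degreeU.
rewrite msuppU1 in_fset1 => /eqP -> [j [c]].
rewrite cmU xpair_eqE -tag_eqE /tag_eq /=.
by have [xy _|] := x =P y; first by rewrite -xy.
Qed.

Lemma hom_fun0 S D : hom_fun S D (fun=> 0).
Proof.
by split; [|apply: (@poly_fun_ext _ _ (fun=> 0)) => [e|]; rewrite ?rmorph0 //];
  apply: poly_fun0.
Qed.

Lemma hom_funD S D f g :
  hom_fun S D f -> hom_fun S D g -> hom_fun S D (fun e => f e + g e).
Proof.
move=> [f1 f2] [g1 g2]; split; first exact: poly_funD.
by apply: poly_fun_ext (poly_funD f2 g2) => e; rewrite rmorphD.
Qed.

Lemma hom_funM S D D' f g :
  hom_fun S D f -> hom_fun S D' g ->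
  hom_fun S (fun x => D x + D' x)%N (fun e => f e * g e).
Proof.
move=> [f1 f2] [g1 g2]; split; first exact: poly_funM.
by apply: poly_fun_ext (poly_funM f2 g2) => e; rewrite rmorphM.
Qed.

Lemma hom_fun_int S (z : int) : hom_fun S (fun=> 0%N) (fun=> z%:~R).
Proof.
split; first exact: poly_fun_int.
by apply: poly_fun_ext (poly_fun_int S z) => e; rewrite rmorph_int.
Qed.

Lemma hom_funZ S D f (z : int) :
  hom_fun S D f -> hom_fun S D (fun e => z%:~R * f e).
Proof. exact: hom_funM (hom_fun_int S z). Qed.

Lemma hom_funN S D f : hom_fun S D f -> hom_fun S D (fun e => - f e).
Proof.
move=> /(hom_funZ (-1)); apply: hom_fun_ext => e.
by rewrite rmorphN1 mulN1r.
Qed.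

Lemma hom_fun_sum S D (I : Type) (r : seq I) (P : pred I) (f : I -> valuation -> F) :
  (forall i, P i -> hom_fun S D (f i)) ->
  hom_fun S D (fun e => \sum_(i <- r | P i) f i e).
Proof.
move=> hf; elim: r => [|i r IHr].
  by apply: hom_fun_ext (hom_fun0 S D) => e; rewrite big_nil.
case Pi: (P i); last by apply: hom_fun_ext IHr => e; rewrite big_cons Pi.
by apply: hom_fun_ext (hom_funD (hf _ Pi) IHr) => e; rewrite big_cons Pi.
Qed.

Lemma hom_fun_prod S (I : Type) (r : seq I) (D : I -> string -> nat)
    (f : I -> valuation -> F) :
  (forall i, hom_fun S (D i) (f i)) ->
  hom_fun S (fun x => \sum_(i <- r) D i x)%N (fun e => \prod_(i <- r) f i e).
Proof.
move=> hf; elim: r => [|i r IHr].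
  apply: hom_fun_degree (hom_fun_ext _ (hom_fun_int S 1)) => [x|e];
  by rewrite big_nil.
apply: hom_fun_degree (hom_fun_ext _ (hom_funM (hf i) IHr)) => [x|e];
by rewrite big_cons.
Qed.

(** Each term of the Leibniz expansion takes one entry from every row. If degrees depend on the row
    only, all the terms have the same degree. *)
Lemma hom_fun_det S m (D : 'I_m -> string -> nat) (A : valuation -> 'M[F]_m) :
  (forall i j, hom_fun S (D i) (fun e => A e i j)) ->
  hom_fun S (fun x => \sum_i D i x)%N (fun e => \det (A e)).
Proof.
move=> hA; apply: hom_fun_sum => s _.
have := hom_funZ ((-1) ^+ s) (hom_fun_prod (index_enum _) (fun i => hA i (s i))).
by apply: hom_fun_ext => e; rewrite rmorphXn rmorphN1.
Qed.

Hypothesis starK : involutive star.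

Lemma hom_fun_var (S : string -> Prop) x (i : subindex d (sort_of x)) : S x ->
  hom_fun S (fun y => (x == y : nat)) (fun e => e x i).
Proof.
by move=> Sx; split; [apply: (poly_fun_var _ false)|apply: (poly_fun_var _ true)].
Qed.

Lemma hom_fun_star S D f : hom_fun S D f -> hom_fun S D (fun e => star (f e)).
Proof. by move=> [f1 f2]; split=> //; apply: poly_fun_ext f1 => e; rewrite starK. Qed.

End HomogeneousFunctions.

(** * Column spaces and kernels *)

Section LinearAlgebra.
Variables (F : fieldType) (d : nat).

Definition cspan N (B : 'M[F]_(d, N)) : {vspace 'cV[F]_d} :=
  limg (linfun (mulmx B : 'cV_N -> 'cV_d)).

Definition rker N (A : 'M[F]_(N, d)) : {vspace 'cV[F]_d} :=
  lker (linfun (mulmx A : 'cV_d -> 'cV_N)).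

Lemma mem_cspan N (B : 'M_(d, N)) v :
  reflect (exists x, v = B *m x) (v \in cspan B).
Proof.
apply: (iffP memv_imgP) => [[x _ ->]|[x ->]]; exists x; rewrite ?lfunE //.
exact: memvf.
Qed.

Lemma mem_rker N (A : 'M_(N, d)) v : (v \in rker A) = (A *m v == 0).
Proof. by rewrite memv_ker lfunE. Qed.

Lemma cspan_row_mx M N (B : 'M_(d, M)) (C : 'M_(d, N)) :
  cspan (row_mx B C) = (cspan B + cspan C)%VS.
Proof.
apply/vspaceP => v; apply/mem_cspan/memv_addP => [[x ->]|].
  exists (B *m usubmx x); first by apply/mem_cspan; exists (usubmx x).
  exists (C *m dsubmx x); first by apply/mem_cspan; exists (dsubmx x).
  by rewrite -{1}[x]vsubmxK mul_row_col.
move=> [_ /mem_cspan[x ->] [_ /mem_cspan[y ->] ->]].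
by exists (col_mx x y); rewrite mul_row_col.
Qed.

(** Duality: a column space is cut out by the functionals vanishing on it. Inclusion thus becomes
    the vanishing of matrix products, given a spanning set of the kernel of [C^T]. *)
Lemma cspan_subP M N (B : 'M_(d, M)) (C : 'M_(d, N)) :
  (cspan B <= cspan C)%VS <->
  (forall w, w \in rker C^T -> B^T *m w = 0).
Proof.
split=> [/subvP sBC w|hw].
  rewrite mem_rker => /eqP Cw; apply/row_matrixP => j; rewrite row0 row_mul -tr_col.
  have : col j B \in cspan C.
    by apply/sBC/mem_cspan; exists (delta_mx j 0); rewrite colE.
  by move=> /mem_cspan[x ->]; rewrite trmx_mul -mulmxA Cw mulmx0.
have /submxP[X BX] : (B^T <= C^T)%MS.
  rewrite submxE; apply/eqP/matrixP => i j.
  have /hw : col j (cokermx C^T) \in rker C^T.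
    by rewrite mem_rker colE mulmxA mulmx_coker mul0mx.
  by rewrite colE mulmxA -colE => /colP/(_ i); rewrite !mxE.
apply/subvP => _ /mem_cspan[x ->]; apply/mem_cspan; exists (X^T *m x).
by rewrite mulmxA -[B]trmxK BX trmx_mul trmxK.
Qed.

(** By semilinearity in the first argument it suffices to be orthogonal to the columns of [B]. The
    factor [c] does not change the kernel; it will be a common denominator of the [alpha k]. *)
Lemma perp_cspan (star : {rmorphism F -> F}) (alpha : 'I_d -> F) (c : F) N
    (B : 'M_(d, N)) : c != 0 ->
  perp star alpha (cspan B) =
  rker (\matrix_(j, k) (c * alpha k * star (B k j))).
Proof.
move=> c0; apply/vspaceP => s; rewrite mem_rker.
have colBE j : (\matrix_(j, k) (c * alpha k * star (B k j)) *m s) j 0 =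
    c * Defs.form star alpha (col j B) s.
  rewrite !mxE /Defs.form mulr_sumr; apply: eq_bigr => k _; rewrite !mxE !mulrA.
  by rewrite -!mulrA; congr (c * _); rewrite mulrCA.
apply/mem_perp/eqP => [hs|As0 _ /mem_cspan[x ->]].
  apply/colP => j; rewrite colBE mxE hs ?mulr0 //.
  by apply/mem_cspan; exists (delta_mx j 0); rewrite colE.
have hj j : Defs.form star alpha (col j B) s = 0.
  by apply/eqP; have := colBE j; rewrite As0 mxE => /esym/eqP; rewrite mulf_eq0 (negbTE c0).
rewrite /Defs.form.
under eq_bigr => k _ do rewrite mxE rmorph_sum !mulr_suml.
rewrite exchange_big big1 //= => j _.
transitivity (star (x j 0) * Defs.form star alpha (col j B) s); last by rewrite hj mulr0.
rewrite /Defs.form mulr_sumr; apply: eq_bigr => k _.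
by rewrite !mxE rmorphM !mulrA [star (B k j) * _]mulrC.
Qed.

(** Cramer's rule: the cofactors along row [l] do not involve that row, so they also expand the
    determinant in which row [i] of [B] has taken its place. *)
Lemma mul_mx_adj_rowsub m N (B : 'M[F]_(N, m)) (f : 'I_m -> 'I_N) i l :
  (B *m \adj (rowsub f B)) i l = \det (rowsub (fun j => if j == l then i else f j) B).
Proof.
rewrite !mxE (expand_det_row _ l); apply: eq_bigr => j _; rewrite !mxE eqxx.
congr (_ * _); rewrite /cofactor; congr (_ * \det _).
by apply/matrixP => a b; rewrite !mxE eq_sym (negbTE (neq_lift _ _)).
Qed.

Lemma mul_adj_mx_colsub m N (A : 'M[F]_(m, N)) (g : 'I_m -> 'I_N) l i :
  (\adj (colsub g A) *m A) l i = \det (colsub (fun j => if j == l then i else g j) A).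
Proof.
rewrite -det_tr trmx_mxsub -mul_mx_adj_rowsub -trmx_mxsub -trmx_adj -trmx_mul.
by rewrite [RHS]mxE.
Qed.

(** Column [k] is the minor times the [k]-th unit vector, corrected in the pivot coordinates [g p]
    so that the rows [f] of [A] annihilate it. All entries are built from minors on the rows [f],
    hence share one degree if degrees in [A] depend on the row only. *)
Definition kerspan m N (A : 'M[F]_(N, d)) (f : 'I_m -> 'I_N) (g : 'I_m -> 'I_d) :
    'M[F]_d :=
  \matrix_(i, k) ((\det (mxsub f g A) *+ (i == k)) -
    \sum_(p | g p == i)
      \det (mxsub f (fun q => if q == p then k else g q) A)).

(** Cramer's rule collects the corrections into an adjugate, followed by the 0-1 matrix placing them
    at the coordinates [g p]. *)
Lemma kerspanE m N (A : 'M[F]_(N, d)) (f : 'I_m -> 'I_N) (g : 'I_m -> 'I_d) :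
  kerspan A f g = (\det (mxsub f g A))%:M -
    \matrix_(i, p) (g p == i)%:R *m (\adj (mxsub f g A) *m rowsub f A).
Proof.
apply/matrixP => i k; rewrite !mxE; congr (_ - _).
rewrite big_mkcond; apply: eq_bigr => p _; rewrite !mxE.
case: ifP => gp; last by rewrite mul0r.
have -> : mxsub f g A = colsub g (rowsub f A) by rewrite -mxsub_comp.
have := mul_adj_mx_colsub (rowsub f A) g p k; rewrite !mxE => ->.
by rewrite mul1r -mxsub_comp.
Qed.

Lemma mul_rowsub_kerspan m N (A : 'M[F]_(N, d)) (f : 'I_m -> 'I_N) (g : 'I_m -> 'I_d) :
  rowsub f A *m kerspan A f g = 0.
Proof.
rewrite kerspanE mulmxBr mul_mx_scalar mulmxA.
have -> : rowsub f A *m \matrix_(i, p) (g p == i)%:R = mxsub f g A.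
  apply/matrixP => i p; rewrite !mxE (bigD1 (g p)) //= !mxE eqxx mulr1 big1 ?addr0 //.
  by move=> k kg; rewrite !mxE eq_sym (negbTE kg) mulr0.
by rewrite mulmxA mul_mx_adj mul_scalar_mx subrr.
Qed.

(** By [kerspanE], solutions of [A *m s = 0] are multiplied by the determinant. *)
Lemma rker_cspan m N (A : 'M[F]_(N, d)) (f : 'I_m -> 'I_N) (g : 'I_m -> 'I_d) :
  \det (mxsub f g A) != 0 -> A *m kerspan A f g = 0 ->
  rker A = cspan (kerspan A f g).
Proof.
move=> det0 AW; apply/vspaceP => s; rewrite mem_rker.
apply/eqP/mem_cspan => [As0|[x ->]]; last by rewrite mulmxA AW mul0mx.
exists ((\det (mxsub f g A))^-1 *: s).
rewrite -scalemxAr kerspanE mulmxBl mul_scalar_mx -!mulmxA.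
have -> : rowsub f A *m s = 0 by rewrite mul_rowsub_mx As0; apply/matrixP => i j; rewrite !mxE.
by rewrite !mulmx0 subr0 scalerA mulVf ?scale1r.
Qed.

(** Take [m] to be the rank, [f] independent rows spanning the row space, and [g] columns completing
    an invertible block. The other rows are combinations of the rows [f], so they annihilate the
    columns too. Bounding [m] by [d] leaves finitely many candidates. *)
Lemma exists_kerspan N (A : 'M[F]_(N, d)) :
  exists (m : 'I_d.+1) (f : {ffun 'I_m -> 'I_N}) (g : {ffun 'I_m -> 'I_d}),
    \det (mxsub f g A) != 0 /\ A *m kerspan A f g = 0.
Proof.
have rA : (\rank A < d.+1)%N by rewrite ltnS rank_leq_col.
set A' := rowsub (maxrankfun A) A.
have fullA' : row_full A'^T by rewrite /row_full mxrank_tr; apply: maxrowsub_free.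
exists (Ordinal rA), (maxrankfun A), (fullrankfun fullA'); split.
  have := fullrowsub_unit fullA'; rewrite unitmxE unitfE -trmx_mxsub det_tr.
  by rewrite /A' -mxsub_comp.
have /submxP[X {1}->] : (A <= A')%MS by rewrite eq_maxrowsub.
by rewrite -mulmxA mul_rowsub_kerspan mulmx0.
Qed.
End LinearAlgebra.

(** * Grassmann-Pluecker coordinates *)

Section GrassmannPlueckerSpan.
Variables (F : fieldType) (d : nat).

Lemma cspan_subv N (B : 'M[F]_(d, N)) (V : {vspace 'cV[F]_d}) :
  (forall j, col j B \in V) -> (cspan B <= V)%VS.
Proof.
move=> BV; apply/subvP => _ /mem_cspan[x ->].
have -> : B *m x = \sum_j x j 0 *: col j B.
  apply/colP => i; rewrite mxE summxE; apply: eq_bigr => j _.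
  by rewrite !mxE mulrC.
by apply: memv_suml => j _; apply: memvZ.
Qed.

Lemma col_cspan N (B : 'M[F]_(d, N)) j : col j B \in cspan B.
Proof. by apply/mem_cspan; exists (delta_mx j 0); rewrite colE. Qed.

(** The coordinates [r] extended to all index tuples by alternation, so that
    signs and orderings need not be considered elsewhere. *)
Definition alt_coord m (r : coords F d m) (f : 'I_m -> 'I_d) : F :=
  if [pick p : subindex d m * {perm 'I_m} |
       [forall j, f j == tnth (val p.1) (p.2 j)]] is Some p
  then (-1) ^+ (p.2 : bool) * r p.1 else 0.

Lemma exists_sorted_index m (f : 'I_m -> 'I_d) : injective f ->
  exists (i : subindex d m) (s : {perm 'I_m}), forall j, f j = tnth (val i) (s j).
Proof.
move=> fI; pose fs := [tuple f j | j < m].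
pose t := [tuple of sort (fun i j : 'I_d => (i <= j)%N) fs].
have permt : perm_eq fs t by rewrite perm_sym perm_sort.
have sortt : sorted (fun i j : 'I_d => (i < j)%N) t.
  have : sorted ltn (map (@nat_of_ord d) t).
    rewrite ltn_sorted_uniq_leq (map_inj_uniq val_inj) -(perm_uniq permt).
    rewrite (map_inj_uniq fI) enum_uniq /= sorted_map.
    by apply: sort_sorted => i j; apply: leq_total.
  by rewrite sorted_map.
have /tuple_permP[s sE] := permt.
exists (exist _ t sortt), s => j.
have := congr1 (fun u => nth (f j) u j) sE.
by rewrite -!tnth_nth !tnth_mktuple.
Qed.

(** If [f] can be sorted, permuting the rows produces exactly the sign of the permutation. Otherwise
    [f] is not injective and a repeated row makes the determinant vanish. *)
Lemma alt_coordE m (B : 'M[F]_(d, m)) c (f : 'I_m -> 'I_d) :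
  alt_coord [ffun i => c * minors B i] f = c * \det (rowsub f B).
Proof.
rewrite /alt_coord; case: pickP => [[i s] /= /forallP fE|no].
  have -> : rowsub f B = row_perm s (rowsub (tnth (val i)) B).
    by apply/matrixP => j k; rewrite !mxE (eqP (fE j)).
  by rewrite row_permE det_mulmx det_perm !ffunE mulrCA.
have /injectivePn[j [k jk fjk]] : ~~ injectiveb f.
  apply/negP => /injectiveP /exists_sorted_index [i [s fE]].
  by have /forallP[] := no (i, s) => j; rewrite /= fE.
rewrite (determinant_alternate jk) ?mulr0 // => l.
by rewrite !mxE fjk.
Qed.

(** In the column of a pair, the second component names the position of the index tuple at which the
    row index [i] is inserted. For [m = 0] there are no such positions, hence no columns, and the
    span is 0. *)
Definition pluecker_mx m (r : coords F d m) :
    'M[F]_(d, #|{: {ffun 'I_m -> 'I_d} * 'I_m}|) :=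
  \matrix_(i, j) let p : {ffun 'I_m -> 'I_d} * 'I_m := enum_val j in
    alt_coord r (fun q => if q == p.2 then i else p.1 q).

(** By Cramer's rule, every column is a multiple of a column of [B *m \adj (rowsub p.1 B)] and so
    lies in [U]; the columns belonging to an invertible block already span [U]. *)
Lemma pluecker_cspan m (U : {vspace 'cV[F]_d}) (r : coords F d m) :
  pluecker U r -> cspan (pluecker_mx r) = U.
Proof.
rewrite /pluecker; case: ifP => [/eqP m0 [dimU _]|_ [dimU [B [c [BU c0 rE]]]]].
  have /eqP -> : U == 0%VS by rewrite -dimv_eq0 dimU m0.
  apply/eqP; rewrite -subv0; apply: cspan_subv => j.
  by case: (enum_val j).2 => l lm; exfalso; rewrite m0 in lm.
have colU j : col j B \in U.
  by rewrite (basis_mem BU) //; apply/tnthP; exists j; rewrite tnth_mktuple.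
have UB : cspan B = U.
  apply/eqP; rewrite eqEsubv cspan_subv //= -(span_basis BU).
  by apply/span_subvP => _ /tnthP[j ->]; rewrite tnth_mktuple col_cspan.
have fullB : row_full B.
  rewrite /row_full -mxrank_tr; apply: inj_row_free => v /(congr1 trmx).
  rewrite trmx_mul trmxK trmx0 => Bv.
  apply/rowP => j; rewrite mxE.
  have /freeP := basis_free BU; apply.
  rewrite -[RHS]Bv; apply/colP => i; rewrite mxE summxE; apply: eq_bigr => k _.
  by rewrite -tnth_nth tnth_mktuple !mxE mulrC.
have col_mxE j : col j (pluecker_mx r) =
    let p : {ffun 'I_m -> 'I_d} * 'I_m := enum_val j in
    c *: col p.2 (B *m \adj (rowsub p.1 B)).
  apply/colP => i; rewrite mxE [LHS]mxE /=.
  rewrite rE; apply: etrans (alt_coordE _ _ _) _.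
  by rewrite -mul_mx_adj_rowsub [RHS]mxE [in RHS]mxE.
apply/eqP; rewrite -UB eqEsubv; apply/andP; split.
  apply: cspan_subv => j.
  by rewrite col_mxE memvZ // colE -mulmxA; apply/mem_cspan; eexists.
(* For an invertible block [f], the adjugate is invertible, so multiplying [B] by it keeps the
   column space. *)
have := fullrowsub_unit fullB; set f := fullrankfun fullB.
rewrite unitmxE unitfE => det0.
have -> : cspan B = cspan (B *m \adj (rowsub f B)).
  apply/vspaceP => v; apply/mem_cspan/mem_cspan => [] [x ->].
    exists ((\det (rowsub f B))^-1 *: (rowsub f B *m x)).
    rewrite -scalemxAr mulmxA -[B *m _ *m _]mulmxA mul_adj_mx mul_mx_scalar.
    by rewrite -scalemxAl scalerA mulVf ?scale1r.
  by exists (\adj (rowsub f B) *m x); rewrite mulmxA.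
apply: cspan_subv => l.
have := col_cspan (pluecker_mx r) (enum_rank (f, l)).
rewrite col_mxE enum_rankK /= => /(memvZ c^-1).
by rewrite scalerA mulVf ?scale1r.
Qed.

Lemma exists_pluecker m (U : {vspace 'cV[F]_d}) :
  \dim U = m -> exists r : coords F d m, pluecker U r.
Proof.
move=> dimU; have [m0|m0] := boolP (m == 0%N).
  by exists 0; split=> //; rewrite m0.
case: m / dimU m0 => m0; pose B := \matrix_(i < d, j < \dim U) (vbasis U)`_j i 0.
exists [ffun i => 1 * minors B i]; split=> //; rewrite (negbTE m0).
exists B, 1; split; rewrite ?oner_eq0 //.
suff -> : [tuple col j B | j < \dim U] = vbasis U by apply: vbasisP.
apply: eq_from_tnth => j; rewrite tnth_mktuple.
by apply/colP => i; rewrite !mxE (tnth_nth 0).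
Qed.

(** Provides values for those quantified strings whose sort differs from the dimension of the
    subspace to be represented. *)
Lemma Gamma_inhabited m : (m <= d)%N -> exists r : coords F d m, Gamma r.
Proof.
move=> md; suff [U dimU] : exists U : {vspace 'cV[F]_d}, \dim U = m.
  by have [r rU] := exists_pluecker dimU; exists r, U.
have dimf : \dim {:'cV[F]_d} = d by rewrite dimvf /dim /= muln1.
exists <<take m (vbasis {:'cV[F]_d})>>%VS; apply/eqP.
have := basis_free (vbasisP {:'cV[F]_d}); rewrite -{1}(cat_take_drop m (vbasis _)).
by move/catl_free; rewrite /free size_takel // size_tuple dimf.
Qed.

End GrassmannPlueckerSpan.

(** * Quantifier free definability *)

Section QuantifierFreeDefinability.
Variables (d : nat) (F : fieldType) (star : {rmorphism F -> F}).
Local Notation string := ('I_d.+1 * nat)%type.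
Local Notation valuation := (forall x : string, coords F d (sort_of x)).
Local Notation L := {vspace 'cV[F]_d}.

Definition qf_def (S : string -> Prop) (P : valuation -> Prop) :=
  exists h : hformula d,
    [/\ homogeneous h, quantifier_free h,
        forall x, is_free (@hatom_occurs d) x h -> S x &
        forall e, hsat star e h <-> P e].

Lemma qf_def_ext S P Q : (forall e, P e <-> Q e) -> qf_def S P -> qf_def S Q.
Proof. by move=> PQ [h [h1 h2 h3 h4]]; exists h; split=> // e; rewrite h4. Qed.

Lemma qf_def_top S : qf_def S (fun=> True).
Proof. by exists (Atom (HTop _)). Qed.

Lemma qf_def_eq0 S D f : hom_fun star S D f -> qf_def S (fun e => f e = 0).
Proof.
move=> [[p [pf pD pS]] _]; exists (Atom (HEq0 p)); split=> //.
  by move=> x; exists (D x) => m /pD.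
by move=> e; rewrite /hsat /= pf.
Qed.

Lemma qf_def_not S P : qf_def S P -> qf_def S (fun e => ~ P e).
Proof.
move=> [h [h1 h2 h3 h4]]; exists (Not h); split=> // e.
by rewrite /hsat /= -/(hsat _ _ _) h4.
Qed.

Lemma qf_def_and S P Q :
  qf_def S P -> qf_def S Q -> qf_def S (fun e => P e /\ Q e).
Proof.
move=> [h [h1 h2 h3 h4]] [g [g1 g2 g3 g4]]; exists (And h g); split=> //=.
- by rewrite h2 g2.
- by move=> x [/h3|/g3].
by move=> e; rewrite /hsat /= -!/(hsat _ _ _) h4 g4.
Qed.

Lemma qf_def_or S P Q :
  qf_def S P -> qf_def S Q -> qf_def S (fun e => P e \/ Q e).
Proof.
move=> [h [h1 h2 h3 h4]] [g [g1 g2 g3 g4]]; exists (Or h g); split=> //=.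
- by rewrite h2 g2.
- by move=> x [/h3|/g3].
by move=> e; rewrite /hsat /= -!/(hsat _ _ _) h4 g4.
Qed.

Lemma qf_def_imp S P Q :
  qf_def S P -> qf_def S Q -> qf_def S (fun e => P e -> Q e).
Proof.
move=> [h [h1 h2 h3 h4]] [g [g1 g2 g3 g4]]; exists (Imp h g); split=> //=.
- by rewrite h2 g2.
- by move=> x [/h3|/g3].
by move=> e; rewrite /hsat /= -!/(hsat _ _ _) h4 g4.
Qed.

Lemma qf_def_forall S (I : finType) (P : I -> valuation -> Prop) :
  (forall i, qf_def S (P i)) -> qf_def S (fun e => forall i, P i e).
Proof.
move=> hP; suff hs (s : seq I) : qf_def S (fun e => forall i, i \in s -> P i e).
  by apply: qf_def_ext (hs (enum I)) => e; split=> h i; last move=> _; apply: h;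
    rewrite ?mem_enum.
elim: s => [|i s IHs]; first exact: qf_def_ext (qf_def_top S).
apply: qf_def_ext (qf_def_and (hP i) IHs) => e; split=> [[Pi Ps] j|h].
  by rewrite in_cons => /predU1P[->|/Ps].
by split=> [|j js]; apply: h; rewrite in_cons ?eqxx ?js ?orbT.
Qed.

Lemma qf_def_if S P Q Q1 Q2 : qf_def S P -> qf_def S Q1 -> qf_def S Q2 ->
  (forall e, P e -> Q e <-> Q1 e) -> (forall e, ~ P e -> Q e <-> Q2 e) ->
  qf_def S Q.
Proof.
move=> hP h1 h2 e1 e2.
apply: qf_def_ext (qf_def_and (qf_def_imp hP h1) (qf_def_imp (qf_def_not hP) h2)).
move=> e; have [Pe|nPe] := classic (P e).
  by rewrite (e1 _ Pe); split=> [[/(_ Pe)]|Q1e]; last by split.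
by rewrite (e2 _ nPe); split=> [[_ /(_ nPe)]|Q2e]; last by split.
Qed.

(** The case distinctions are there because a spanning set of a kernel is
    polynomial only once a nonvanishing minor of maximal size is singled out. *)
Inductive tame (S : string -> Prop) : (valuation -> L) -> Prop :=
| TameSpan N (D : 'I_N -> string -> nat) (B : valuation -> 'M[F]_(d, N)) C :
    (forall i j, hom_fun star S (D j) (fun e => B e i j)) ->
    (forall e, C e = cspan (B e)) -> tame S C
| TameIf P C1 C2 C : qf_def S P -> tame S C1 -> tame S C2 ->
    (forall e, P e -> C e = C1 e) -> (forall e, ~ P e -> C e = C2 e) ->
    tame S C.

Lemma tame0 S : tame S (fun=> 0%VS).
Proof.
apply: (@TameSpan _ 0 (fun _ _ => 0%N) (fun=> 0)) => [_ [] //|e].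
by apply/esym/eqP; rewrite -subv0; apply: cspan_subv => [[]].
Qed.

Lemma tameD S C1 C2 : tame S C1 -> tame S C2 -> tame S (fun e => C1 e + C2 e)%VS.
Proof.
move=> h1; elim: h1 C2 => {C1} [M D B C1 BD BE|P C11 C12 C1 hP h11 IH1 h12 IH2 E1 E2] C2 h2.
  elim: h2 => {C2} [N D' B' C2 BD' BE'|P C21 C22 C2 hP h21 IH1 h22 IH2 E1 E2].
    pose D2 j := match split j with inl k => D k | inr k => D' k end.
    apply: (@TameSpan _ _ D2 (fun e => row_mx (B e) (B' e))) => [i j|e].
      apply: hom_fun_ext (_ : hom_fun star S (D2 j) (fun e => match split j with
        inl k => B e i k | inr k => B' e i k end)) => [e|]; first by rewrite mxE.
      by rewrite /D2; case: split.
    by rewrite cspan_row_mx BE BE'.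
  by apply: TameIf hP IH1 IH2 _ _ => e he; rewrite ?(E1 _ he) ?(E2 _ he).
apply: TameIf hP (IH1 _ h2) (IH2 _ h2) _ _ => e he;
by rewrite ?(E1 _ he) ?(E2 _ he).
Qed.

(** Some [kerspan] matrix spans the kernel, but which one depends on the valuation. The test [P t]
    that the candidate [t] works is quantifier free, so a nested case distinction over the finitely
    many candidates selects one. *)
Lemma tame_rker S N (D : 'I_N -> string -> nat) (A : valuation -> 'M[F]_(N, d)) :
  (forall j k, hom_fun star S (D j) (fun e => A e j k)) ->
  tame S (fun e => rker (A e)).
Proof.
move=> AD.
pose T := {m : 'I_d.+1 & {ffun 'I_m -> 'I_N} * {ffun 'I_m -> 'I_d}}%type.
pose f_ (t : T) : {ffun 'I_(tag t) -> 'I_N} := (tagged t).1.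
pose g_ (t : T) : {ffun 'I_(tag t) -> 'I_d} := (tagged t).2.
pose W e (t : T) := kerspan (A e) (f_ t) (g_ t).
pose P (t : T) e := \det (mxsub (f_ t) (g_ t) (A e)) <> 0 /\ A e *m W e t = 0.
have detD m (f : 'I_m -> 'I_N) (g : 'I_m -> 'I_d) :
    hom_fun star S (fun x => \sum_i D (f i) x)%N (fun e => \det (mxsub f g (A e))).
  by apply: hom_fun_det => i j; apply: hom_fun_ext (AD (f i) (g j)) => e; rewrite mxE.
have WD t i k : hom_fun star S
    (fun x => \sum_i D (f_ t i) x)%N (fun e => W e t i k).
  (* Whether the diagonal term is present depends on the indices only, and 0 has the degree of the
     other terms. *)
  apply: (@hom_fun_ext _ _ _ _ _ (fun e =>
    (if i == k then \det (mxsub (f_ t) (g_ t) (A e)) else 0) +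
    - \sum_(p | g_ t p == i) \det (mxsub (f_ t)
        (fun q => if q == p then k else g_ t q) (A e)))) => [e|].
    by rewrite /W mxE; case: eqP.
  apply: hom_funD.
    case: eqP => _; first exact: detD.
    exact: hom_fun0.
  by apply/hom_funN/hom_fun_sum => p _; apply: detD.
have Pdef t : qf_def S (P t).
  apply: qf_def_and; first by apply: qf_def_not; apply: qf_def_eq0 (detD _ _ _).
  pose PW (ik : 'I_N * 'I_d) e := (A e *m W e t) ik.1 ik.2 = 0.
  apply: (@qf_def_ext _ (fun e => forall ik, PW ik e)) => [e|].
    split=> [h|AW ik]; last by rewrite /PW AW mxE.
    by apply/matrixP => i k; rewrite [LHS](h (i, k)) mxE.
  apply: qf_def_forall => [[i k]]; rewrite /PW /=.
  apply: qf_def_ext (qf_def_eq0 (hom_fun_sum (index_enum _) (P := predT)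
    (fun l _ => hom_funM (AD i l) (WD t l k)))) => e.
  by rewrite mxE.
have tameW t : tame S (fun e => cspan (W e t)).
  by apply: (TameSpan (B := fun e => W e t)) => // i j; apply: WD.
have Pcover e : exists2 t, t \in enum {: T} & P t e.
  have [m [f [g [det0 AW]]]] := exists_kerspan (A e).
  exists (Tagged (fun m : 'I_d.+1 =>
    ({ffun 'I_m -> 'I_N} * {ffun 'I_m -> 'I_d})%type) (f, g)).
    by rewrite mem_enum.
  by split=> //; apply/eqP.
have PE t e : P t e -> rker (A e) = cspan (W e t).
  by move=> [/eqP det0 AW]; apply: rker_cspan.
(* Induction on the list of candidates still to be tried. The value 0 where all of them fail is a
   placeholder: by [Pcover] this does not happen for the full list. *)
suff hs (s : seq T) C : (forall e, (exists2 t, t \in s & P t e) -> C e = rker (A e)) ->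
   (forall e, ~ (exists2 t, t \in s & P t e) -> C e = 0%VS) -> tame S C.
  by apply: (hs (enum {: T})) => // e; case; apply: Pcover.
elim: s C => [|t s IHs] C C1 C2.
  (* A case distinction on a true condition merely replaces [C] by a function with the same
     values. *)
  apply: (@TameIf _ (fun=> True) _ _ _ (qf_def_top S) (tame0 S) (tame0 S)) => // e _.
  by apply: C2 => [[]].
pose Cs e := if excluded_middle_informative (exists2 t, t \in s & P t e)
  then rker (A e) else 0%VS.
apply: (@TameIf _ (P t) _ _ _ (Pdef t) (tameW t) (IHs Cs _ _)).
- by move=> e; rewrite /Cs; case: excluded_middle_informative.
- by move=> e; rewrite /Cs; case: excluded_middle_informative.
- by move=> e Pe; rewrite C1 ?(PE _ _ Pe) //; exists t; rewrite ?mem_head.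
move=> e Pe; rewrite /Cs; case: excluded_middle_informative => [[u us Pu]|no].
  by apply: C1; exists u; rewrite ?in_cons ?us ?orbT.
apply: C2 => [[u]]; rewrite in_cons => /predU1P[->//|us Pu].
by apply: no; exists u.
Qed.

(** Resolving the case distinctions on both sides leaves two column spaces, compared by
    [cspan_subP]. The kernel occurring there brings its own case distinctions; once these are
    resolved, the entries of one matrix product have to vanish. *)
Lemma qf_def_sub S C1 C2 :
  tame S C1 -> tame S C2 -> qf_def S (fun e => (C1 e <= C2 e)%VS).
Proof.
move=> h1 h2; elim: h2 => {C2} [N D' B' C2 BD' BE'|P C21 C22 C2 hP h21 IH1 h22 IH2 E1 E2];
  last by apply: qf_def_if hP IH1 IH2 _ _ => e he; rewrite ?(E1 _ he) ?(E2 _ he).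
elim: h1 => {C1} [M D B C1 BD BE|P C11 C12 C1 hP h11 IH1 h12 IH2 E1 E2];
  last by apply: qf_def_if hP IH1 IH2 _ _ => e he; rewrite ?(E1 _ he) ?(E2 _ he).
pose Q K e := forall w, w \in (K e : L) -> (B e)^T *m w = 0.
suff hQ K : tame S K -> qf_def S (Q K).
  apply: qf_def_ext (hQ (fun e => rker (B' e)^T) _) => [e|].
    by rewrite BE BE' /Q -cspan_subP.
  (* Transposition turns the column degrees of a spanning matrix into the row degrees required for a
     kernel. *)
  apply: (@tame_rker _ _ D') => j k.
  by apply: hom_fun_ext (BD' k j) => e; rewrite mxE.
elim=> {K} [K DK BK C CD CE|P K1 K2 K hP hK1 IH1 hK2 IH2 E1 E2]; last first.
  by apply: qf_def_if hP IH1 IH2 _ _ => e he; rewrite /Q ?(E1 _ he) ?(E2 _ he).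
pose PW (ik : 'I_M * 'I_K) e := ((B e)^T *m BK e) ik.1 ik.2 = 0.
apply: (@qf_def_ext _ (fun e => forall ik, PW ik e)) => [e|].
  split=> [h w|h [i k]]; rewrite ?CE.
    move=> /mem_cspan[x ->]; rewrite mulmxA (_ : _ *m BK e = 0) ?mul0mx //.
    by apply/matrixP => i k; rewrite [LHS](h (i, k)) mxE.
  have /h : col k (BK e) \in C e by rewrite CE col_cspan.
  by rewrite /PW colE mulmxA -colE => /colP/(_ i); rewrite !mxE.
apply: qf_def_forall => [[i k]]; rewrite /PW /=.
apply: qf_def_ext (qf_def_eq0 (hom_fun_sum (index_enum _) (P := predT)
    (fun l _ => hom_funM (BD l i) (CD l k)))) => e.
by rewrite mxE; under [in X in _ <-> X]eq_bigr => l _ do rewrite mxE.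
Qed.

Hypothesis starK : involutive star.

(** * Lattice terms and quantifier free lattice formulas *)

Section LatticeTerms.
Variables (alpha : 'I_d -> F) (c : F) (a : 'I_d -> int).
Hypotheses (c0 : c != 0) (alphaE : forall k, c * alpha k = (a k)%:~R).

(** The equations of the orthogonal have as rows the conjugated columns of [B], with integer
    coefficients [a k]. Conjugation preserves degrees, so the kernel is tame. *)
Lemma tame_perp S C : tame S C -> tame S (fun e => perp star alpha (C e)).
Proof.
elim=> {C} [N D B C BD BE|P C1 C2 C hP h1 IH1 h2 IH2 E1 E2]; last first.
  by apply: TameIf hP IH1 IH2 _ _ => e he; rewrite ?(E1 _ he) ?(E2 _ he).
have : tame S (fun e => rker (\matrix_(j, k) (c * alpha k * star (B e k j)))).
  apply: (@tame_rker _ _ D) => j k.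
  apply: hom_fun_ext (hom_funZ (a k) (hom_fun_star starK (BD k j))) => e.
  by rewrite mxE alphaE.
move=> h; apply: TameIf (qf_def_top S) h (tame0 S) _ _ => // e _.
by rewrite BE (perp_cspan _ _ _ c0).
Qed.

(** Defined for every valuation; it is the subspace with coordinates [e x] as soon as these lie in
    [Gamma]. *)
Definition subspace_of (e : valuation) (x : string) : L :=
  cspan (pluecker_mx (e x)).

Lemma tame_subspace_of (S : string -> Prop) x :
  S x -> tame S (fun e => subspace_of e x).
Proof.
move=> Sx; apply: (TameSpan (D := fun _ y => (x == y : nat))
  (B := fun e => pluecker_mx (e x))) => // i j.
apply: (@hom_fun_ext _ _ _ _ _ (fun e => alt_coord (e x)
  (fun q => if q == (enum_val j : {ffun 'I_(sort_of x) -> 'I_d} * 'I_(sort_of x)).2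
            then i else (enum_val j : {ffun 'I_(sort_of x) -> 'I_d} * 'I_(sort_of x)).1 q))).
  by move=> e; rewrite mxE.
(* The sorting permutation depends on the index tuple and not on the valuation, so the entry is 0 or
   a single variable up to sign. *)
rewrite /alt_coord; case: pickP => [[t s] _|_]; last exact: hom_fun0.
have := hom_funZ ((-1) ^+ perm.odd_perm s) (hom_fun_var star t Sx).
by apply: hom_fun_ext => e; rewrite rmorphXn rmorphN1.
Qed.

Lemma tame_leval S (rho : nat -> string) t :
  (forall x, S (rho x)) ->
  tame S (fun e => leval star alpha (fun x => subspace_of e (rho x)) t).
Proof.
move=> Srho; elim: t => [x||t1 IH1 t2 IH2|t IHt] /=.
- exact: tame_subspace_of.
- exact: tame0.
- exact: tameD.
exact: tame_perp.
Qed.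

Lemma qf_def_lsat S (rho : nat -> string) (phi : lformula) :
  (forall x, S (rho x)) -> quantifier_free phi ->
  qf_def S (fun e => lsat star alpha (fun x => subspace_of e (rho x)) phi).
Proof.
move=> Srho; rewrite /lsat; elim: phi => //= [[s t] _|f IHf qf|f IHf g IHg|f IHf g IHg|f IHf g IHg].
- have hs := tame_leval s Srho; have ht := tame_leval t Srho.
  apply: qf_def_ext (qf_def_and (qf_def_sub hs ht) (qf_def_sub ht hs)) => e /=.
  by split=> [[? ?]|->//]; apply/eqP; rewrite eqEsubv; apply/andP.
- exact: qf_def_not (IHf qf).
- by move=> /andP[/IHf ? /IHg ?]; apply: qf_def_and.
- by move=> /andP[/IHf ? /IHg ?]; apply: qf_def_or.
by move=> /andP[/IHf ? /IHg ?]; apply: qf_def_imp.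
Qed.

End LatticeTerms.
End QuantifierFreeDefinability.

(** Fractions of integers form a subfield. Denominators are required to be nonzero in [F], which in
    positive characteristic is more than being nonzero integers. *)
Lemma prime_subfield_frac (F : fieldType) (x : F) : prime_subfield x ->
  exists2 c : int, c%:~R != 0 :> F & exists a : int, c%:~R * x = a%:~R.
Proof.
move=> /(_ (fun x => exists2 c : int, c%:~R != 0 :> F &
  exists a : int, c%:~R * x = a%:~R)); apply.
- by exists 1; rewrite ?oner_eq0 //; exists 1; rewrite mulr1.
- move=> {}x y [c c0 [a xE]] [c' c0' [a' yE]]; exists (c * c').
    by rewrite intrM mulf_neq0.
  exists (c' * a - c * a').
  by rewrite rmorphB /= !intrM -xE -yE mulrBr !mulrA [c'%:~R * _]mulrC.
move=> {}x y [c c0 [a xE]] [c' c0' [a' yE]].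
(* Division is total: [x / 0] is 0. *)
have [->|y0] := eqVneq y 0.
  by exists 1; rewrite ?oner_eq0 //; exists 0; rewrite invr0 !mulr0.
have a0' : a'%:~R != 0 :> F by rewrite -yE mulf_neq0.
exists (c * a'); first by rewrite intrM mulf_neq0.
exists (c' * a); rewrite !intrM -xE -yE.
by rewrite -!mulrA [y * _]mulrC mulfVK // mulrCA.
Qed.

Lemma common_denominator (F : fieldType) (I : finType) (x : I -> F) :
  (forall i, prime_subfield (x i)) ->
  exists (c : F) (a : I -> int), c != 0 /\ forall i, c * x i = (a i)%:~R.
Proof.
move=> hx.
have /fin_all_exists[ca caP] i : exists ca : int * int,
    ca.1%:~R != 0 :> F /\ ca.1%:~R * x i = ca.2%:~R.
  by have [c c0 [a xE]] := prime_subfield_frac (hx i); exists (c, a).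
exists (\prod_i (ca i).1)%:~R, (fun i => (ca i).2 * \prod_(j | j != i) (ca j).1).
split=> [|i]; first by rewrite rmorph_prod; apply/prodf_neq0 => i _; case: (caP i).
by rewrite (bigD1 i) //= !intrM mulrAC; case: (caP i) => _ ->.
Qed.

(** * Prenex formulas *)

Section LatticeFormulas.
Variables (F : fieldType) (star : {rmorphism F -> F}) (d : nat).
Variable alpha : 'I_d -> F.
Local Notation L := {vspace 'cV[F]_d}.

Lemma leval_eq_occurs (u v : nat -> L) t :
  (forall x, lterm_occurs t x -> u x = v x) ->
  leval star alpha u t = leval star alpha v t.
Proof.
elim: t => //= [x|s IHs t IHt|t IHt] uv; first exact: uv.
  by rewrite IHs ?IHt // => x tx; apply: uv; [right|left].
by rewrite IHt.
Qed.

Lemma lsat_eq_free (u v : nat -> L) (phi : lformula) :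
  (forall x, is_free latom_occurs x phi -> u x = v x) ->
  lsat star alpha u phi <-> lsat star alpha v phi.
Proof.
rewrite /lsat; elim: phi u v => //=.
- move=> [s t] u v uv /=.
  by rewrite !(@leval_eq_occurs u v) // => x tx; apply: uv; [right|left].
- by move=> f IHf u v uv; rewrite (IHf u v).
- by move=> f IHf g IHg u v uv; rewrite (IHf u v) ?(IHg u v) // => x fx; apply: uv;
    [right|left].
- by move=> f IHf g IHg u v uv; rewrite (IHf u v) ?(IHg u v) // => x fx; apply: uv;
    [right|left].
- by move=> f IHf g IHg u v uv; rewrite (IHf u v) ?(IHg u v) // => x fx; apply: uv;
    [right|left].
move=> q x f IHf u v uv.
have IH w : sat (T := fun=> L) (fun _ _ => True)
    (fun e a => leval star alpha e a.1 = leval star alpha e a.2) (@dfwith _ (fun=> L) u x w) f <->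
  sat (T := fun=> L) (fun _ _ => True)
    (fun e a => leval star alpha e a.1 = leval star alpha e a.2) (@dfwith _ (fun=> L) v x w) f.
  apply: IHf => y fy; have [<-|xy] := eqVneq x y; first by rewrite !dfwith_in.
  by rewrite !dfwith_out //; apply: uv; split=> // yx; rewrite yx eqxx in xy.
case: q; split=> /=.
- by move=> [w _ /IH hw]; exists w.
- by move=> [w _ /IH hw]; exists w.
- by move=> h w _; apply/IH/h.
by move=> h w _; apply/IH/h.
Qed.

End LatticeFormulas.

Section Prenexing.
Variables (d : nat) (F : fieldType) (star : {rmorphism F -> F}).
Variable alpha : 'I_d -> F.
Local Notation string := ('I_d.+1 * nat)%type.
Local Notation valuation := (forall x : string, coords F d (sort_of x)).
Local Notation L := {vspace 'cV[F]_d}.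
Local Notation Gam e s := (@Gamma F d (sort_of s) (e s)).

(** A block of like quantifiers amounts to one quantification over valuations changed on [ss] only.
    Repetitions in [ss] are harmless, the innermost value being the one that counts. *)
Lemma hsat_quants q (h : hformula d) ss (e : valuation) :
  hsat star e (foldr (Quant q) h ss) <->
  match q with
  | Qex => exists e' : valuation, [/\ forall s, s \notin ss -> e' s = e s,
      forall s, s \in ss -> Gam e' s & hsat star e' h]
  | Qall => forall e' : valuation, (forall s, s \notin ss -> e' s = e s) ->
      (forall s, s \in ss -> Gam e' s) -> hsat star e' h
  end.
Proof.
elim: ss e => [|s ss IHss] e /=.
  have eE (e' : valuation) : (forall s, s \notin [::] -> e' s = e s) -> e' = e.
    by move=> ee'; apply: functional_extensionality_dep => s; apply: ee'.
  case: q; split.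
  - by move=> he; exists e.
  - by move=> [e' [/eE -> _]].
  - by move=> he e' /eE ->.
  - exact.
have outE (e' : valuation) y : (forall s', s' \notin s :: ss -> e' s' = e s') ->
    y \notin ss -> e' y = dfwith e (e' s) y.
  move=> ee' yss; have [<-|sy] := eqVneq s y; first by rewrite dfwith_in.
  by rewrite dfwith_out // ee' // in_cons negb_or eq_sym sy.
case: q IHss => IHss; rewrite /hsat /=; split.
- move=> [v Gv /IHss[e' [ee' Ge' he']]].
  have e's : s \notin ss -> e' s = v by move=> /ee' ->; rewrite dfwith_in.
  exists e'; split=> // y; rewrite in_cons.
    by rewrite negb_or => /andP[ys /ee' ->]; rewrite dfwith_out // eq_sym.
  have [yss _|yss] := boolP (y \in ss); first exact: Ge'.
  by rewrite orbF => /eqP ys; move: yss; rewrite ys => /e's ->.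
- move=> [e' [ee' Ge' he']]; exists (e' s); first by apply: Ge'; rewrite mem_head.
  apply/IHss; exists e'; split=> // y yss; first exact: outE.
  by apply: Ge'; rewrite in_cons yss orbT.
- move=> he e' ee' Ge'.
  have /IHss := he (e' s) (Ge' s (mem_head _ _)); apply=> y yss; first exact: outE.
  by apply: Ge'; rewrite in_cons yss orbT.
move=> he v Gv; apply/IHss => e' ee' Ge'; apply: he => y; rewrite in_cons.
  by rewrite negb_or => /andP[ys /ee' ->]; rewrite dfwith_out // eq_sym.
have [yss _|yss] := boolP (y \in ss); first exact: Ge'.
by rewrite orbF => /eqP ys; move: yss; rewrite ys => /ee' ->; rewrite dfwith_in.
Qed.

(** Disjunctions [Node Qex] and conjunctions [Node Qall] of leaves; a leaf [rho]
    represents the instance of a lattice formula which has the string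
    [nth s0 rho x] in place of the variable [x]. *)
Inductive tree := Leaf of seq string | Node of quantifier & tree & tree.

Fixpoint leaves t :=
  match t with
  | Leaf rho => [:: rho]
  | Node _ t1 t2 => leaves t1 ++ leaves t2
  end.

Fixpoint tsat (P : seq string -> Prop) t : Prop :=
  match t with
  | Leaf rho => P rho
  | Node Qex t1 t2 => tsat P t1 \/ tsat P t2
  | Node Qall t1 t2 => tsat P t1 /\ tsat P t2
  end.

Lemma tsat_impl (P Q : seq string -> Prop) t :
  (forall rho, rho \in leaves t -> P rho -> Q rho) -> tsat P t -> tsat Q t.
Proof.
elim: t => [rho|q t1 IH1 t2 IH2] /= PQ; first by apply: PQ; rewrite mem_head.
have h1 : tsat P t1 -> tsat Q t1.
  by apply: IH1 => rho rhot; apply: PQ; rewrite mem_cat rhot.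
have h2 : tsat P t2 -> tsat Q t2.
  by apply: IH2 => rho rhot; apply: PQ; rewrite mem_cat rhot orbT.
by case: q => -[]; [left; apply: h1|right; apply: h2|split; [apply: h1|apply: h2]].
Qed.

(** There is no empty tree, so the fold starts from a second copy of the leaf for [ord0]. *)
Definition branch q (f : 'I_d.+1 -> seq string) : tree :=
  foldr (fun m => Node q (Leaf (f m))) (Leaf (f ord0)) (enum 'I_d.+1).

Lemma tsat_branch P q f : tsat P (branch q f) <->
  if q is Qex then exists m, P (f m) else forall m, P (f m).
Proof.
have hs s : tsat P (foldr (fun m => Node q (Leaf (f m))) (Leaf (f ord0)) s) <->
    if q is Qex then exists2 m, m \in ord0 :: s & P (f m)
    else forall m, m \in ord0 :: s -> P (f m).
  elim: s => [|m s IHs] /=.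
    case: q; split.
    - by exists ord0.
    - by move=> [m /[!inE]/eqP->].
    - by move=> Pf m /[!inE]/eqP->.
    - by apply; rewrite mem_head.
  case: q IHs => IHs; rewrite IHs; split.
  - move=> [Pm|[k ks Pk]]; first by exists m; rewrite ?inE ?eqxx ?orbT.
    by exists k => //; move: ks; rewrite !inE => /orP[->//|->]; rewrite !orbT.
  - move=> [k]; rewrite !inE => /or3P[k0|/eqP->|ks] Pk; last 1 first.
    + by right; exists k; rewrite // inE ks orbT.
    + by right; exists k; rewrite // inE k0.
    + by left.
  - move=> [Pm Ps] k; rewrite !inE => /or3P[k0|/eqP->//|ks];
    by apply: Ps; rewrite inE ?k0 ?ks ?orbT.
  move=> h; split=> [|k]; first by apply: h; rewrite !inE eqxx orbT.
  by rewrite inE => /orP[k0|ks]; apply: h; rewrite !inE ?k0 ?ks ?orbT.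
rewrite /branch hs; case: q {hs}; split.
- by move=> [m _ Pm]; exists m.
- by move=> [m Pm]; exists m; rewrite // inE mem_enum orbT.
- by move=> h m; apply: h; rewrite inE mem_enum orbT.
by move=> h m _.
Qed.

Lemma leaves_branch q f rho : rho \in leaves (branch q f) -> exists m, rho = f m.
Proof.
rewrite /branch; elim: (enum 'I_d.+1) => [|m s IHs] /=; rewrite inE.
  by move=> /eqP ->; exists ord0.
by move=> /orP[/eqP->|//]; exists m.
Qed.

Variable s0 : string.

(** * Distributing a quantifier over the leaves of a tree *)

Section Expand.
Variables (q : quantifier) (x N : nat).

(** Distinct leaves need distinct strings, so that a quantifier over all of these
    strings can be moved through the conjunctions and disjunctions. *)
Definition fresh (rho : seq string) (m : 'I_d.+1) : string := (m, N + choice.pickle rho)%N.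

(** Entry [x] of a leaf is overwritten, as rebinding the variable [x] demands. *)
Fixpoint expand t :=
  match t with
  | Leaf rho => branch q (fun m => set_nth s0 rho x (fresh rho m))
  | Node q' t1 t2 => Node q' (expand t1) (expand t2)
  end.

Definition fresh_strings t := [seq fresh rho m | rho <- leaves t, m <- enum 'I_d.+1].

Lemma tsat_expand P t : tsat P (expand t) <->
  tsat (fun rho =>
    if q is Qex then exists m, P (set_nth s0 rho x (fresh rho m))
    else forall m, P (set_nth s0 rho x (fresh rho m))) t.
Proof.
elim: t => [rho|q' t1 IH1 t2 IH2] /=; first exact: tsat_branch.
by case: q'; rewrite IH1 IH2.
Qed.

Lemma leaves_expand rho t : rho \in leaves (expand t) ->
  exists2 rho', rho' \in leaves t & exists m, rho = set_nth s0 rho' x (fresh rho' m).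
Proof.
elim: t => [rho'|q' t1 IH1 t2 IH2] /=.
  by move=> /leaves_branch[m ->]; exists rho'; rewrite ?mem_head //; exists m.
rewrite mem_cat => /orP[/IH1|/IH2] [rho' rho't [m ->]];
by exists rho'; rewrite ?mem_cat ?rho't ?orbT //; exists m.
Qed.

Lemma mem_fresh_strings rho m t :
  rho \in leaves t -> fresh rho m \in fresh_strings t.
Proof. by move=> rhot; apply/allpairsP; exists (rho, m); rewrite mem_enum. Qed.

End Expand.

Definition instance (e : valuation) (rho : seq string) (y : nat) : L :=
  subspace_of e (nth s0 rho y).

Lemma fresh_bound t : exists N, forall rho y,
  rho \in leaves t -> ((nth s0 rho y).2 < N)%N.
Proof.
exists (\max_(rho <- leaves t) \max_(s <- s0 :: rho) s.2).+1 => rho y rhot.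
rewrite ltnS; pose F0 (rho : seq string) := \max_(s <- s0 :: rho) s.2.
apply: (@leq_trans (F0 rho)); last exact: (leq_bigmax_seq (F := F0) rho rhot).
apply: (leq_bigmax_seq (F := fun s : string => s.2) (nth s0 rho y)) => //.
have [yr|yr] := ltnP y (size rho); first by rewrite in_cons mem_nth ?orbT.
by rewrite nth_default // mem_head.
Qed.

(** Evaluating at [W] decides the quantified statement, so that one value serves
    all Boolean combinations at once. *)
Lemma exists_decisive_value q (P : L -> Prop) : exists W,
  if q is Qex then (exists V, P V) -> P W else P W -> forall V, P V.
Proof.
case: q.
  have [[V PV]|no] := classic (exists V, P V); first by exists V.
  by exists 0%VS.
have [[V nPV]|no] := classic (exists V, ~ P V); first by exists V.
by exists 0%VS => _ V; apply: NNPP => nPV; apply: no; exists V.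
Qed.

(** At each leaf, the fresh string whose sort is the dimension of [W rho] receives coordinates of
    [W rho]; other fresh strings get arbitrary elements of [Gamma]. The choices do not conflict
    because [pickle] is injective on leaves. *)
Lemma exists_valuation (N : nat) (t : tree) (W : seq string -> L) (e : valuation) :
  exists e' : valuation,
    [/\ forall s, s \notin fresh_strings N t -> e' s = e s,
        forall s, s \in fresh_strings N t -> Gam e' s &
        forall rho, rho \in leaves t ->
          subspace_of e' (fresh N rho (inord (\dim (W rho)))) = W rho].
Proof.
have dimE rho : (inord (\dim (W rho)) : 'I_d.+1) = \dim (W rho) :> nat.
  by rewrite inordK // ltnS (leq_trans (dimvS (subvf _))) // dimvf /dim /= muln1.
have exr s : exists r : coords F d (sort_of s), Gamma r /\
    forall rho, s = fresh N rho (inord (\dim (W rho))) -> cspan (pluecker_mx r) = W rho.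
  have [[rho sE]|no] := classic (exists rho, s = fresh N rho (inord (\dim (W rho)))).
    have dimW : \dim (W rho) = sort_of s by rewrite sE /sort_of /= dimE.
    have [r rW] := exists_pluecker dimW.
    exists r; split=> [|rho' sE']; first by exists (W rho).
    suff -> : rho' = rho by apply: pluecker_cspan.
    have := congr1 snd sE'; rewrite {1}sE /= => /addnI/esym.
    exact: (pcan_inj choice.pickleK).
  have [r Gr] := @Gamma_inhabited F d (sort_of s) (ltn_ord s.1).
  by exists r; split=> // rho sE; case: no; exists rho.
pose r s := proj1_sig (constructive_indefinite_description _ (exr s)).
have rP s := proj2_sig (constructive_indefinite_description _ (exr s)).
exists (fun s => if s \in fresh_strings N t then r s else e s); split.
- by move=> s /negbTE ->.
- by move=> s st; rewrite st; case: (rP s).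
move=> rho rhot; rewrite /subspace_of mem_fresh_strings //.
by case: (rP (fresh N rho (inord (\dim (W rho))))) => _; apply.
Qed.

(** Trees are monotone in their leaves, so leafwise implications suffice. A valuation of the fresh
    strings yields subspaces at all leaves; conversely [e1] realizes decisive values [W rho] at all
    leaves at once. The latter proves the implication to the left for [Qex] and to the right for
    [Qall]. *)
Lemma hsat_expand q x phi t N (h : hformula d) (e : valuation) :
  (forall rho y, rho \in leaves t -> ((nth s0 rho y).2 < N)%N) ->
  (forall e', hsat star e' h <->
    tsat (fun rho => lsat star alpha (instance e' rho) phi) (expand q x N t)) ->
  hsat star e (foldr (Quant q) h (fresh_strings N t)) <->
  tsat (fun rho => lsat star alpha (instance e rho) (Quant q x phi)) t.
Proof.
move=> ltN hE.
(* Fresh strings are numbered from [N] on and those of the leaves below [N], so only the value at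
   [x] changes. *)
have instE (e' : valuation) rho m :
    (forall s, s \notin fresh_strings N t -> e' s = e s) -> rho \in leaves t ->
    instance e' (set_nth s0 rho x (fresh N rho m)) =
    @dfwith _ (fun=> L) (instance e rho) x (subspace_of e' (fresh N rho m)).
  move=> ee' rhot; apply: functional_extensionality => y.
  rewrite /instance nth_set_nth /=; have [->|yx] := eqVneq y x.
    by rewrite dfwith_in.
  rewrite dfwith_out 1?eq_sym // /subspace_of ee' //.
  apply/negP => /allpairsP[[rho' m'] /= [_ _ yE]].
  by have := ltN _ y rhot; rewrite yE /= ltnNge leq_addr.
pose P rho V :=
  lsat star alpha (@dfwith _ (fun=> L) (instance e rho) x V) phi.
have [W WP] : exists W : seq string -> L, forall rho,
    if q is Qex then (exists V, P rho V) -> P rho (W rho)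
    else P rho (W rho) -> forall V, P rho V.
  exists (fun rho => proj1_sig (constructive_indefinite_description _
    (exists_decisive_value q (P rho)))) => rho.
  exact: proj2_sig (constructive_indefinite_description _
    (exists_decisive_value q (P rho))).
have [e1 [ee1 Ge1 e1W]] := exists_valuation N t W e.
rewrite hsat_quants; case: q WP hE => WP hE.
  split=> [[e' [ee' Ge' /hE/tsat_expand]]|h1].
    apply: tsat_impl => rho rhot [m]; rewrite instE // => he'.
    by exists (subspace_of e' (fresh N rho m)).
  exists e1; split=> //; apply/hE/tsat_expand; apply: tsat_impl h1 => rho rhot.
  move=> [V _ PV]; exists (inord (\dim (W rho))).
  by rewrite instE // e1W //; apply: WP; exists V.
split=> [h1|h1 e' ee' Ge'].
  have /hE/tsat_expand := h1 _ ee1 Ge1; apply: tsat_impl => rho rhot.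
  move=> /(_ (inord (\dim (W rho)))); rewrite instE // e1W // => /WP PV V _.
  exact: PV.
apply/hE/tsat_expand; apply: tsat_impl h1 => rho rhot PV m.
by rewrite instE //; apply: PV.
Qed.

Lemma prenex_quants q k (h : hformula d) ss : (0 < size ss)%N ->
  prenex q k.+1 h \/ prenex (dual q) k h ->
  prenex q k.+1 (foldr (Quant q) h ss).
Proof.
case: ss => // s ss _ hh; elim: ss s => [|s' ss IHss] s /=.
  by case: hh => hh; [apply: PrenexSame|apply: PrenexSwitch].
by apply: PrenexSame; apply: IHss.
Qed.

Hypothesis starK : involutive star.
Variables (c : F) (a : 'I_d -> int).
Hypotheses (c0 : c != 0) (alphaE : forall k, c * alpha k = (a k)%:~R).

(** The induction on the prefix is carried out for all trees at once: passing a quantifier expands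
    the tree beneath it, and the connectives of the tree are written down only at the quantifier
    free matrix. *)
Lemma exists_prenex_hformula q k (phi : lformula) : prenex q k phi -> forall t,
  exists h : hformula d,
    [/\ homogeneous h, prenex q k h,
        forall s, is_free (@hatom_occurs d) s h ->
          exists rho y, rho \in leaves t /\ s = nth s0 rho y &
        forall e, hsat star e h <->
          tsat (fun rho => lsat star alpha (instance e rho) phi) t].
Proof.
have step q' k' x f t : (forall t, exists h : hformula d,
    [/\ homogeneous h, prenex q' k'.+1 h \/ prenex (dual q') k' h,
        forall s, is_free (@hatom_occurs d) s h ->
          exists rho y, rho \in leaves t /\ s = nth s0 rho y &
        forall e, hsat star e h <->
          tsat (fun rho => lsat star alpha (instance e rho) f) t]) ->
  exists h : hformula d,
    [/\ homogeneous h, prenex q' k'.+1 h,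
        forall s, is_free (@hatom_occurs d) s h ->
          exists rho y, rho \in leaves t /\ s = nth s0 rho y &
        forall e, hsat star e h <->
          tsat (fun rho => lsat star alpha (instance e rho) (Quant q' x f)) t].
  have [N ltN] := fresh_bound t.
  move=> /(_ (expand q' x N t))[h [h1 h2 h3 h4]].
  exists (foldr (Quant q') h (fresh_strings N t)); split.
  - by elim: fresh_strings.
  (* A tree has at least one leaf, so the block is nonempty and may continue the first block of [h]
     or precede it. *)
  - apply: prenex_quants h2; rewrite size_allpairs size_enum_ord muln_gt0 andbT.
    by elim: t {ltN h3 h4} => //= q1 t1 IH1 t2 _; rewrite size_cat addn_gt0 IH1.
  (* A free string of [h] comes from an expanded leaf: at position [x] it is fresh, hence bound by
     the new block, and elsewhere it belongs to an old leaf. *)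
  - move=> s sh; have [sN fsh] : s \notin fresh_strings N t /\ is_free (@hatom_occurs d) s h.
      elim: fresh_strings sh => //= y ss IHss [sy /IHss[sss ?]]; split=> //.
      by rewrite inE negb_or sss andbT; apply/eqP.
    have [rho [y [/leaves_expand[rho' rhot [m ->]] sE]]] := h3 _ fsh.
    exists rho', y; split=> //; move: sE sN; rewrite nth_set_nth /=.
    by case: eqP => // _ ->; rewrite mem_fresh_strings.
  by move=> e; apply: hsat_expand.
elim=> {q k phi} [q k f qf t|q k x f _ IH t|q k x f _ IH t]; last 2 first.
- by apply: step => t'; have [h [h1 h2 h3 h4]] := IH t'; exists h; split=> //; left.
- by apply: step => t'; have [h [h1 h2 h3 h4]] := IH t'; exists h; split=> //; right.
suff [h [h1 h2 h3 h4]] : qf_def star (fun s => exists rho y, rho \in leaves t /\ s = nth s0 rho y)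
    (fun e => tsat (fun rho => lsat star alpha (instance e rho) f) t).
  by exists h; split=> //; apply: PrenexQF.
have leafP S rho : (forall y, S (nth s0 rho y)) ->
    qf_def star S (fun e => lsat star alpha (instance e rho) f).
  move=> Srho.
  exact: (qf_def_lsat starK c0 alphaE (rho := fun y => nth s0 rho y) Srho qf).
suff hS t' (S : string -> Prop) : (forall rho y, rho \in leaves t' -> S (nth s0 rho y)) ->
    qf_def star S (fun e => tsat (fun rho => lsat star alpha (instance e rho) f) t').
  by apply: hS => rho y rhot; exists rho, y.
elim: t' => [rho|q' t1 IH1 t2 IH2] /= hS.
  by apply: leafP => y; apply: hS; rewrite mem_head.
have {IH1}h1 : qf_def star S (fun e => tsat (fun rho => lsat star alpha (instance e rho) f) t1).
  by apply: IH1 => rho y rhot; apply: hS; rewrite mem_cat rhot.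
have {IH2}h2 : qf_def star S (fun e => tsat (fun rho => lsat star alpha (instance e rho) f) t2).
  by apply: IH2 => rho y rhot; apply: hS; rewrite mem_cat rhot orbT.
by case: q' => /=; [apply: qf_def_or|apply: qf_def_and].
Qed.

End Prenexing.

(** The prefix construction is applied to a single leaf listing the free strings; their coordinates
    give back the subspaces by [pluecker_cspan]. *)
Lemma exists_hformula (F : fieldType) (star : {rmorphism F -> F})
    (starK : involutive star) (d : nat) (alpha : 'I_d -> F)
    (alpha_prime : forall i, prime_subfield (alpha i)) (n : nat) (n_gt0 : (0 < n)%N)
    (q : quantifier) (k : nat) (phi : lformula) (dd : n.-tuple 'I_d.+1) :
  prenex q k phi -> (forall x, is_free latom_occurs x phi -> (x < n)%N) ->
  exists chi : hformula d,
    [/\ homogeneous chi, prenex q k chi,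
        forall x, is_free (@hatom_occurs d) x chi -> exists i, x = free_string dd i &
        forall (e : forall x, coords F d (sort_of x)) (U : n.-tuple {vspace 'cV[F]_d}),
          (forall i, pluecker (m := tnth dd i) (tnth U i) (e (free_string dd i))) ->
          hsat star e chi <-> lsat star alpha (nth 0%VS U) phi].
Proof.
move=> qphi phin; have [c [a [c0 alphaE]]] := common_denominator alpha_prime.
(* The default for variables numbered from [n] on is itself an admissible free string, which exists
   as [n] is positive. *)
pose s0 := free_string dd (Ordinal n_gt0).
pose rho0 := [seq free_string dd i | i <- enum 'I_n].
have rho0E (i : 'I_n) : nth s0 rho0 i = free_string dd i.
  by rewrite (nth_map (Ordinal n_gt0)) ?size_enum_ord // nth_ord_enum.
have [h [h1 h2 h3 h4]] :=
  exists_prenex_hformula s0 starK c0 alphaE qphi (Leaf rho0).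
exists h; split=> // [x /h3[rho [y [/[!inE]/eqP-> ->]]]|e U UE].
  have [yn|yn] := ltnP y n; first by exists (Ordinal yn); rewrite -rho0E.
  by exists (Ordinal n_gt0); rewrite nth_default // size_map size_enum_ord.
rewrite h4 /=; apply: lsat_eq_free => x /phin xn.
rewrite /instance (rho0E (Ordinal xn)) /subspace_of (pluecker_cspan (UE (Ordinal xn))).
by rewrite (tnth_nth 0%VS).
Qed.

Theorem theorem17 (F : fieldType) (star : {rmorphism F -> F})
    (starK : involutive star) (d : nat) (d_gt0 : (0 < d)%N)
    (alpha : 'I_d -> F) (alpha_prime : forall i, prime_subfield (alpha i))
    (alpha_adm : admissible star alpha)
    (n : nat) (n_gt0 : (0 < n)%N) (k : nat) (k_gt0 : (0 < k)%N) :
  (forall (q : quantifier) (dd : n.-tuple 'I_d.+1)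
      (M : n.-tuple {vspace 'cV[F]_d} -> Prop) (phi : lformula),
     prenex q k phi ->
     ldefines star alpha
       (fun u : n.-tuple {vspace 'cV[F]_d} =>
          forall i, \dim (tnth u i) = tnth dd i) phi M ->
     exists chi : hformula d,
       [/\ homogeneous chi, prenex q k chi &
           hdefines star dd chi (theta dd M)]) /\
  (forall (q : quantifier)
      (M : n.-tuple {vspace 'cV[F]_d} -> Prop) (phi : lformula),
     prenex q k phi ->
     ldefines star alpha (fun=> True) phi M ->
     exists chi : n.-tuple 'I_d.+1 -> hformula d,
       forall dd : n.-tuple 'I_d.+1,
         [/\ homogeneous (chi dd), prenex q k (chi dd) &
             hdefines star dd (chi dd) (theta dd M)]).
Proof.
(* Covers both parts: [N] is the dimension condition in (a) and trivially true in (b), so it holds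
   for all tuples of dimensions [dd]. *)
have definable q (dd : n.-tuple 'I_d.+1) (N M : n.-tuple {vspace 'cV[F]_d} -> Prop) phi :
    prenex q k phi -> ldefines star alpha N phi M ->
    (forall u : n.-tuple _, (forall i, \dim (tnth u i) = tnth dd i) -> N u) ->
    exists chi : hformula d,
      [/\ homogeneous chi, prenex q k chi & hdefines star dd chi (theta dd M)].
  move=> qphi [phin MP] dimN.
  have [chi [chi1 chi2 chi3 chi4]] :=
    exists_hformula starK alpha_prime n_gt0 dd qphi phin.
  exists chi; split=> //; split=> // e; split=> [[U UE /MP[_ hU]]|[Ge he]].
    by split=> [i|]; [exists (tnth U i); apply: UE|apply/(chi4 e U)].
  have /fin_all_exists[u uE] := Ge.
  have UE i : pluecker (m := tnth dd i) (tnth [tuple u j | j < n] i) (e (free_string dd i)).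
    by rewrite tnth_mktuple; apply: uE.
  exists [tuple u j | j < n] => //; apply/MP; split; last by apply/(chi4 e).
  by apply: dimN => i; case: (UE i).
split=> [q dd M phi qphi hM|q M phi qphi hM]; first exact: definable qphi hM _.
(* Finite choice over the dimension vectors collects the components of the disjunction. *)
have /fin_all_exists[chi chiE] := fun dd => definable q dd _ M phi qphi hM (fun _ _ => I).
by exists chi.
Qed.
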